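(* Let $\mathcal{P}$ be a non-trivial hereditary graph property such that the unlabeled speed $s^*_{\mathcal{P}}(n)$ is not ultimately constant with value $0$ or $1$ (i.e. for neither $c=0$ nor $c=1$ does $s^*_{\mathcal{P}}(n)=c$ hold for all sufficiently large $n$). Then there are infinitely many pairs of graphs which are $\chi_{\mathcal{P}}$-mates.
   Context: All graphs are finite, simple, loop-free and have at least one vertex. A graph property $\mathcal{P}$ is a class of graphs closed under isomorphism. It is trivial if it is empty, contains only finitely many graphs up to isomorphism, or contains all graphs; otherwise it is non-trivial. It is hereditary if it is closed under induced subgraphs. $s^*_{\mathcal{P}}(n)$ is the number of isomorphism classes of graphs of order $n$ in $\mathcal{P}$. For a graph $G$ of order $n$, $h_i^{\mathcal{P}}(G)$ is the number of partitions of $V(G)$ into exactly $i$ nonempty blocks such that each block $B$ induces a graph $G[B]\in\mathcal{P}$. The Harary polynomial is $\chi_{\mathcal{P}}(G;k)=\sum_{i=1}^{n} h_i^{\mathcal{P}}(G)\,k_{(i)}$, where $k_{(i)}=k(k-1)\cdots(k-i+1)$. Two non-isomorphic graphs $G,H$ are $\chi_{\mathcal{P}}$-mates if $\chi_{\mathcal{P}}(G;k)=\chi_{\mathcal{P}}(H;k)$ as polynomials. *)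

(* Defs.v *)
From mathcomp Require Import all_boot all_order all_algebra.
From mathcomp Require Import boolp.

Set Implicit Arguments.
Unset Strict Implicit.
Unset Printing Implicit Defensive.

Import GRing.Theory.

Record graph := Graph {
  vertex :> finType;
  edge : rel vertex;
  edge_sym : symmetric edge;
  edge_irr : irreflexive edge;
  vertex_gt0 : 0 < #|vertex| }.

Arguments edge {g}.

Definition graph_order (G : graph) : nat := #|G|.

Definition iso (G H : graph) : Prop :=
  exists2 f : G -> H, bijective f & {mono f : x y / edge x y}.

Section Induced.
Variables (G : graph) (B : {set G}).

Definition induced_edge : rel {x : G | x \in B} :=
  fun x y => edge (val x) (val y).

Lemma induced_edge_sym : symmetric induced_edge.
Proof. by move=> x y; apply: edge_sym. Qed.

Lemma induced_edge_irr : irreflexive induced_edge.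
Proof. by move=> x; apply: edge_irr. Qed.

Lemma induced_gt0 (B0 : B != set0) : 0 < #|{: {x : G | x \in B}}|.
Proof. by rewrite card_sig card_gt0. Qed.

Definition induced (B0 : B != set0) : graph :=
  Graph induced_edge_sym induced_edge_irr (induced_gt0 B0).

End Induced.

Definition finite_upto (T : Type) (R : T -> T -> Prop) (A : T -> Prop) : Prop :=
  exists (m : nat) (F : 'I_m -> T), forall x, A x -> exists i, R x (F i).

Definition iso_closed (P : graph -> Prop) : Prop :=
  forall G H : graph, iso G H -> P G -> P H.

Definition trivial_property (P : graph -> Prop) : Prop :=
  [\/ forall G, ~ P G, finite_upto iso P | forall G, P G].

Definition hereditary (P : graph -> Prop) : Prop :=
  forall (G : graph) (B : {set G}) (B0 : B != set0), P G -> P (induced B0).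

Section Labelled.
Variable n : nat.

Definition labelled :=
  {e : {ffun 'I_n.+1 * 'I_n.+1 -> bool} |
    [forall x, forall y, e (x, y) == e (y, x)] && [forall x, ~~ e (x, x)]}.

Variable e : labelled.

Definition labelled_edge : rel 'I_n.+1 := fun x y => val e (x, y).

Lemma labelled_edge_sym : symmetric labelled_edge.
Proof. by move=> x y; have /andP[/forallP/(_ x)/forallP/(_ y)/eqP] := valP e. Qed.

Lemma labelled_edge_irr : irreflexive labelled_edge.
Proof. by move=> x; have /andP[_ /forallP/(_ x)/negbTE] := valP e. Qed.

Lemma labelled_gt0 : 0 < #|'I_n.+1|.
Proof. by rewrite card_ord. Qed.

Definition graph_of_labelled : graph :=
  Graph labelled_edge_sym labelled_edge_irr labelled_gt0.

End Labelled.

(* Isomorphism classes of graphs of order n are counted as classes of labelled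
   graphs on {0, ..., n - 1}; there is no graph of order 0. *)
Definition unlabelled_speed (P : graph -> Prop) (n : nat) : nat :=
  if n is m.+1 then
    #|equivalence_partition
        (fun e f : labelled m =>
           `[< iso (graph_of_labelled e) (graph_of_labelled f) >])
        [set e : labelled m | `[< P (graph_of_labelled e) >]]|
  else 0.

Definition ultimately_constant (s : nat -> nat) (c : nat) : Prop :=
  exists N, forall n, N <= n -> s n = c.

Definition block_in (P : graph -> Prop) (G : graph) (B : {set G}) : Prop :=
  exists B0 : B != set0, P (induced B0).

Definition harary_coef (P : graph -> Prop) (G : graph) (i : nat) : nat :=
  #|[set Q : {set {set G}} |
      [&& partition Q [set: G], #|Q| == i & [forall B in Q, `[< block_in P B >]]]]|.

Definition falling_poly (i : nat) : {poly int} :=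
  (\prod_(j < i) ('X - (j%:R)%:P))%R.

Definition harary_poly (P : graph -> Prop) (G : graph) : {poly int} :=
  (\sum_(1 <= i < (graph_order G).+1) (harary_coef P G i)%:R *: falling_poly i)%R.

Definition mates (P : graph -> Prop) (p : graph * graph) : Prop :=
  ~ iso p.1 p.2 /\ harary_poly P p.1 = harary_poly P p.2.

(* Isomorphism of unordered pairs of graphs. *)
Definition pair_iso (p q : graph * graph) : Prop :=
  (iso p.1 q.1 /\ iso p.2 q.2) \/ (iso p.1 q.2 /\ iso p.2 q.1).

(* Main.v *)
Require Import Defs.
From mathcomp Require Import all_boot all_order all_algebra.
From mathcomp Require Import boolp.

(** If [G] lies in a hereditary property [P], then every partition of [V(G)]
    is admissible, so [harary_coef P G i] is a Stirling number and depends only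
    on the order of [G].  Hence any two non-isomorphic members of [P] of the
    same order are mates.  Heredity also makes the speed vanish from the first
    [n > 0] where it vanishes; so under the hypotheses it is at least 2 at
    arbitrarily large [n]. *)

Lemma iso_sym (G H : graph) : iso G H -> iso H G.
Proof.
move=> [f [g fK gK] fm]; exists g; first by exists f.
by move=> x y; rewrite -fm !gK.
Qed.

Lemma iso_trans (G H K : graph) : iso G H -> iso H K -> iso G K.
Proof.
move=> [f fb fm] [g gb gm]; exists (g \o f); first exact: bij_comp.
by move=> x y; rewrite /= gm fm.
Qed.

Lemma iso_order (G H : graph) : iso G H -> graph_order G = graph_order H.
Proof. by move=> [f fb _]; apply: bij_eq_card fb. Qed.

Lemma order_induced (G : graph) (B : {set G}) (B0 : B != set0) :
  graph_order (induced B0) = #|B|.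
Proof. exact: card_sig. Qed.

Lemma subset_of_card {T : finType} {n : nat} :
  n <= #|T| -> exists B : {set T}, #|B| = n.
Proof.
move=> len; exists [set x in take n (enum T)].
rewrite cardsE (card_uniqP _) ?take_uniq ?enum_uniq //.
by rewrite size_takel // -cardE.
Qed.

(** The speed counts labelled graphs only, so an arbitrary graph is replaced by a labelled copy, its
    edges pulled back along the enumeration [g] of its vertices. *)
Lemma iso_labelled (G : graph) (n : nat) :
  graph_order G = n.+1 -> exists e : labelled n, iso G (graph_of_labelled e).
Proof.
move=> Gn; pose g (i : 'I_n.+1) : G := enum_val (cast_ord (esym Gn) i).
pose e := [ffun p : 'I_n.+1 * 'I_n.+1 => edge (g p.1) (g p.2)].
have eP : [forall x, forall y, e (x, y) == e (y, x)] && [forall x, ~~ e (x, x)].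
  apply/andP; split; apply/forallP => x; last by rewrite ffunE edge_irr.
  by apply/forallP => y; rewrite !ffunE edge_sym.
exists (exist _ e eP); apply: iso_sym; exists g.
  exists (fun x => cast_ord Gn (enum_rank x)) => x.
    by rewrite /g enum_valK cast_ordKV.
  by rewrite /g cast_ordK enum_rankK.
by move=> x y; rewrite /edge /= /labelled_edge /= ffunE.
Qed.

(** Related elements have equal classes, so representatives of two distinct classes are
    unrelated. *)
Lemma equivalence_partition_gt1 {T : finType} {R : rel T} {D : {set T}} :
  symmetric R -> transitive R -> 1 < #|equivalence_partition R D| ->
  exists x y, [/\ x \in D, y \in D & ~~ R x y].
Proof.
move=> Rs Rt /card_gt1P[A [B [/imsetP[x xD ->] /imsetP[y yD ->] neq]]].
exists x, y; split=> //; apply: contra neq => Rxy; apply/eqP/setP => z.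
by rewrite !inE (left_trans Rs Rt Rxy).
Qed.

Section HereditaryProperty.
Variable P : graph -> Prop.
Hypotheses (P_iso : iso_closed P) (P_hereditary : hereditary P).

Lemma speed_gt0P (n : nat) :
  0 < unlabelled_speed P n.+1 <-> exists2 G, P G & graph_order G = n.+1.
Proof.
split=> [|[G PG Gn]].
  case/card_gt0P=> A /imsetP[e]; rewrite inE => /asboolP Pe _.
  by exists (graph_of_labelled e); rewrite // /graph_order card_ord.
have [e Ge] := iso_labelled G n Gn; apply/card_gt0P; eexists.
by apply/imsetP; exists e; rewrite // inE; apply/asboolP/(P_iso _ _ Ge).
Qed.

Lemma speed_gt1 (n : nat) : 1 < unlabelled_speed P n.+1 ->
  exists e f : labelled n, [/\ P (graph_of_labelled e),
    P (graph_of_labelled f) &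
    ~ iso (graph_of_labelled e) (graph_of_labelled f)].
Proof.
case/equivalence_partition_gt1 => [e f | f e g |].
- by apply/asboolP/asboolP; apply: iso_sym.
- by move=> /asboolP ef /asboolP fg; apply/asboolP/(iso_trans _ _ _ ef fg).
- move=> e [f]; rewrite !inE => -[/asboolP Pe /asboolP Pf /asboolP nef].
  by exists e, f.
Qed.

(** Any [m] vertices of a member of order [n] induce a member of order [m]. The bound [0 < m]
    reflects that the speed at 0 is 0 by convention. *)
Lemma speed_gt0_le (m n : nat) : 0 < m <= n ->
  0 < unlabelled_speed P n -> 0 < unlabelled_speed P m.
Proof.
case: m n => [|m] [|n] //= lemn /speed_gt0P[G PG Gn].
have [|B Bm] := @subset_of_card G m.+1; first by rewrite -/(graph_order G) Gn.
have B0 : B != set0 by rewrite -card_gt0 Bm.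
apply/speed_gt0P; exists (induced B0); first exact: P_hereditary.
by rewrite order_induced.
Qed.

Lemma harary_coef_hereditary (G : graph) (i : nat) : P G ->
  harary_coef P G i =
  #|[set Q : {set {set G}} | partition Q [set: G] & #|Q| == i]|.
Proof.
move=> PG; apply: eq_card => Q; rewrite !inE.
case: (boolP (partition Q _)) => //= /and3P[_ _ Q0].
rewrite andb_idr // => _; apply/forall_inP => B BQ; apply/asboolP.
(* The nonemptiness that [block_in] demands is part of being a partition. *)
have B0 : B != set0 by apply: contraNneq Q0 => <-.
by exists B0; apply: P_hereditary.
Qed.

(** Both graphs have vertex type ['I_n.+1] by conversion, so once admissibility is dropped the two
    sums agree term by term. *)
Lemma harary_poly_labelled (n : nat) (e f : labelled n) :
  P (graph_of_labelled e) -> P (graph_of_labelled f) ->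
  harary_poly P (graph_of_labelled e) = harary_poly P (graph_of_labelled f).
Proof.
by move=> Pe Pf; apply: eq_bigr => i _; rewrite !harary_coef_hereditary.
Qed.

Lemma speed_unbounded_gt1 :
  ~ ultimately_constant (unlabelled_speed P) 0 ->
  ~ ultimately_constant (unlabelled_speed P) 1 ->
  forall N, exists2 n, N <= n & 1 < unlabelled_speed P n.
Proof.
move=> not0 not1 N.
have speed_gt0 m : 0 < m -> 0 < unlabelled_speed P m.
  move=> m_gt0; rewrite lt0n; apply/eqP => sm0; apply: not0; exists m => n lemn.
  apply/eqP; rewrite -leqn0 leqNgt; apply/negP => sn.
  by have := @speed_gt0_le m n; rewrite m_gt0 lemn sm0 => /(_ isT sn).
(* Otherwise the speed would be exactly 1 from [N.+1] on; starting there rather than at [N] keeps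
   [n] positive. *)
apply: contrapT => noN; apply: not1; exists N.+1 => n ltNn.
apply/eqP; rewrite eqn_leq speed_gt0 ?(leq_ltn_trans _ ltNn) // andbT leqNgt.
by apply/negP => sn; apply: noN; exists n; first exact: ltnW.
Qed.

End HereditaryProperty.

Theorem theorem5p5 (P : graph -> Prop)
  (P_iso : iso_closed P)
  (P_nontrivial : ~ trivial_property P)
  (P_hereditary : hereditary P)
  (speed_not0 : ~ ultimately_constant (unlabelled_speed P) 0)
  (speed_not1 : ~ ultimately_constant (unlabelled_speed P) 1) :
  ~ finite_upto pair_iso (mates P).
Proof.
move=> [m [F FP]].
(* [N] bounds the orders of all graphs in the finite list, so a pair of mates of order above [N]
   matches no entry. *)
pose N := \max_(i < m) maxn (graph_order (F i).1) (graph_order (F i).2).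
have [[//|n] ltNn] :=
  speed_unbounded_gt1 _ P_iso P_hereditary speed_not0 speed_not1 N.+1.
case/speed_gt1=> e [f [Pe Pf nef]].
have [|i ief] := FP (graph_of_labelled e, graph_of_labelled f).
  by split=> //; apply: harary_poly_labelled.
have : maxn (graph_order (F i).1) (graph_order (F i).2) <= N.
  exact: (leq_bigmax (F := fun i =>
    maxn (graph_order (F i).1) (graph_order (F i).2))).
rewrite geq_max => /andP[le1 le2].
have order_e : graph_order (graph_of_labelled e) = n.+1 by apply: card_ord.
suff : n.+1 <= N by rewrite leqNgt ltNn.
(* In either orientation of the match, the graph of [e] has the order of a component of [F i]. *)
by rewrite -order_e; case: ief => -[/iso_order -> _].
Qed.
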